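(* Let $U=[0,1]^2$ and let $S\subset U$ be any finite set of points with $(0,0)\in S$. Then the GreedyPacking algorithm (with the processing order defined in the context) outputs a lower-left anchored rectangle packing $R$ of $S$ whose total covered area satisfies $\mathrm{area}(R)\ge 0.10390$.
   Context: For a point $p$, $x(p)$ and $y(p)$ denote its coordinates. A rectangle is lower-left anchored at $p$ if it is an axis-parallel rectangle with lower-left corner $p$ (a point or segment counts as a degenerate rectangle of area $0$). A lower-left anchored rectangle packing (LLARP) of $S$ is a set of axis-parallel rectangles contained in $U$, pairwise interior-disjoint, one rectangle lower-left anchored at each point of $S$, none containing a point of $S$ in its interior. The GreedyPacking algorithm: fix a total order of $S$ in which $p$ comes before $q$ whenever $x(p)+y(p)>x(q)+y(q)$ (ties broken arbitrarily but consistently). Start with $R=\emptyset$; process the points of $S$ in this order (largest coordinate sum first), and for the current point $p$ add to $R$ a maximum-area rectangle contained in $U$, lower-left anchored at $p$, interior-disjoint from all rectangles already in $R$ and containing no point of $S$ in its interior. Return $R$. $\mathrm{area}(R)$ is the area of the union of the rectangles in $R$. *)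

(* Defs.v *)
From mathcomp Require Import all_boot all_order all_algebra.
From mathcomp Require Import reals.
Set Implicit Arguments. Unset Strict Implicit. Unset Printing Implicit Defensive.
Import Order.TTheory GRing.Theory Num.Theory.
Local Open Scope ring_scope.

Section LLARP.
Variable R : realType.

Definition pt := (R * R)%type.
Definition xc (p : pt) : R := p.1.
Definition yc (p : pt) : R := p.2.

Definition inU (p : pt) : Prop := 0 <= xc p <= 1 /\ 0 <= yc p <= 1.

(* axis-parallel (possibly degenerate) rectangle [x, x+w] x [y, y+h]
   with lower-left corner (x,y), w >= 0, h >= 0 *)
Record rect := Rect { corner : pt; width : R; height : R }.

Definition rect_ok (r : rect) : Prop := 0 <= width r /\ 0 <= height r.

Definition area (r : rect) : R := width r * height r.

Definition anchored_at (r : rect) (p : pt) : Prop := rect_ok r /\ corner r = p.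

Definition rect_in_U (r : rect) : Prop :=
  0 <= xc (corner r) /\ xc (corner r) + width r <= 1 /\
  0 <= yc (corner r) /\ yc (corner r) + height r <= 1.

Definition in_interior (r : rect) (z : pt) : Prop :=
  xc (corner r) < xc z < xc (corner r) + width r /\
  yc (corner r) < yc z < yc (corner r) + height r.

Definition interior_disjoint (r1 r2 : rect) : Prop :=
  forall z : pt, ~ (in_interior r1 z /\ in_interior r2 z).

Definition empty_of (S : seq pt) (r : rect) : Prop :=
  forall q, q \in S -> ~ in_interior r q.

(* Lower-left anchored rectangle packing of S (S given as a duplicate-free
   list): the list Rs contains exactly one rectangle anchored at each point
   of S, all contained in U, pairwise interior-disjoint, and none contains
   a point of S in its interior. *)
Definition is_LLARP (S : seq pt) (Rs : seq rect) : Prop :=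
  perm_eq (map corner Rs) S /\
  (forall i, (i < size Rs)%N -> rect_ok (nth (Rect (0,0) 0 0) Rs i)) /\
  (forall i, (i < size Rs)%N -> rect_in_U (nth (Rect (0,0) 0 0) Rs i)) /\
  (forall i j, (i < size Rs)%N -> (j < size Rs)%N -> i <> j ->
     interior_disjoint (nth (Rect (0,0) 0 0) Rs i) (nth (Rect (0,0) 0 0) Rs j)) /\
  (forall i, (i < size Rs)%N -> empty_of S (nth (Rect (0,0) 0 0) Rs i)).

(* total covered area: sum of the areas (the rectangles of a packing are
   interior-disjoint, so this is the area of their union) *)
Definition total_area (Rs : seq rect) : R := \sum_(r <- Rs) area r.

Definition greedy_order (S ord : seq pt) : Prop :=
  perm_eq ord S /\ sorted (fun p q => xc q + yc q <= xc p + yc p) ord.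

Definition candidate (S : seq pt) (prev : seq rect) (p : pt) (r : rect) : Prop :=
  anchored_at r p /\ rect_in_U r /\
  (forall k, (k < size prev)%N -> interior_disjoint r (nth (Rect (0,0) 0 0) prev k)) /\
  empty_of S r.

Definition greedy_run (S ord : seq pt) (Rs : seq rect) : Prop :=
  size Rs = size ord /\
  forall i, (i < size ord)%N ->
    candidate S (take i Rs) (nth (0,0) ord i) (nth (Rect (0,0) 0 0) Rs i) /\
    (forall r, candidate S (take i Rs) (nth (0,0) ord i) r ->
       area r <= area (nth (Rect (0,0) 0 0) Rs i)).

End LLARP.

(* Main.v *)
Require Import Defs.
From mathcomp Require Import all_boot all_order all_algebra.
From mathcomp Require Import boolp classical_sets reals ereal topology normedtype.
From mathcomp Require Import derive measure lebesgue_measure lebesgue_integral.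
From mathcomp Require Import ring lra.
Set Implicit Arguments. Unset Strict Implicit. Unset Printing Implicit Defensive.
Import Order.TTheory GRing.Theory Num.Theory numFieldNormedType.Exports.
Local Open Scope ring_scope.

(** The tile of a point p is the set of z >= p that dominate no point preceding
    p; the tiles partition the unit square, and the greedy area A of p is at
    least (u - x(p)) (v - y(p)) for every (u, v) in the tile of p.  So the tile
    lies below a hyperbola, and it can only be much larger than A if it has a
    long horizontal or vertical arm.  Let a be the width of the tile, and w the
    abscissa (relative to p) at which its height drops to its height at 2a/3.
    Beyond w the tile fits in a rectangle of area at most 3A/2; between sqrt A
    and w its area grows only logarithmically in w^2/A.  On the other hand, in
    the coordinates (x, x + y) the rectangles of size (a - w) x w with corner
    (x(p) + w, x(p) + y(p)) are pairwise disjoint, whence the sum of (a - w) w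
    over all points is at most 2.  As (a - w) w >= w^2/2, the logarithm can be
    charged to these rectangles, and likewise for the vertical arms. *)

(** * Covering and packing inequalities from planar Lebesgue measure *)

Section PlaneArea.
Context {R : realType}.
Local Open Scope classical_set_scope.
Implicit Types (r t : rect R) (T : seq (rect R)) (z : pt R).

(* [b] decides whether the right and top sides are excluded. *)
Definition mem_box (b : bool) r z : bool :=
  (xc z \in Interval (BLeft (xc (corner r))) (BSide b (xc (corner r) + width r)))
  && (yc z \in Interval (BLeft (yc (corner r)))
                        (BSide b (yc (corner r) + height r))).

Definition rect_okb r : bool := (0 <= width r) && (0 <= height r).

Local Notation mu := (@lebesgue_measure R \x @lebesgue_measure R)%E.

Lemma mem_boxE b r :
  [set` mem_box b r] =
  [set` Interval (BLeft (xc (corner r))) (BSide b (xc (corner r) + width r))] `*`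
  [set` Interval (BLeft (yc (corner r))) (BSide b (yc (corner r) + height r))].
Proof. by apply/seteqP; split=> z /=; [move/andP | move=> [? ?]; apply/andP]. Qed.

Lemma measurable_box b r : measurable [set` mem_box b r].
Proof. by rewrite mem_boxE; apply: measurableX; exact: measurable_itv. Qed.

Lemma measure_box b r : rect_okb r -> mu [set` mem_box b r] = (area r)%:E.
Proof.
have len (x w : R) : 0 <= w ->
  lebesgue_measure [set` Interval (BLeft x) (BSide b (x + w))] = w%:E.
  move=> w0; rewrite lebesgue_measure_itv /= lte_fin.
  case: ltP => [_|]; first by rewrite -EFinD addrC addKr.
  by rewrite gerDl => w1; congr EFin; apply/eqP; rewrite eq_le w0 w1.
case/andP=> w0 h0; rewrite mem_boxE product_measure1E; last 2 first.
- exact: measurable_itv.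
- exact: measurable_itv.
by rewrite EFinM; congr (_ * _)%E; exact: len.
Qed.

Lemma boxes_cons b t T :
  [set z | has (mem_box b ^~ z) (t :: T)] =
  [set` mem_box b t] `|` [set z | has (mem_box b ^~ z) T].
Proof. by apply/seteqP; split=> z /=; [move/orP | move=> H; apply/orP]. Qed.

Lemma measurable_boxes b T : measurable [set z | has (mem_box b ^~ z) T].
Proof.
elim: T => [|t T IH]; last first.
  by rewrite boxes_cons; apply: measurableU => //; exact: measurable_box.
by rewrite (_ : [set _ | _] = set0)//; apply/seteqP; split.
Qed.

(** Finite subadditivity. Tiles are half-open, so only the half-open version of [r] has to be
    covered, while the covering boxes keep all their sides. *)
Lemma area_cover r T : rect_okb r -> all rect_okb T ->
  (forall z, mem_box true r z -> has (mem_box false ^~ z) T) ->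
  area r <= \sum_(t <- T) area t.
Proof.
move=> r0 T0 rT.
have: (mu [set z | has (mem_box false ^~ z) T] <= (\sum_(t <- T) area t)%:E)%E.
  elim: T T0 {rT} => [|t T IH] /= => [_|/andP[t0 /IH{}IH]].
    rewrite big_nil (_ : [set _ | _] = set0); first by rewrite measure0.
    by apply/seteqP; split.
  rewrite boxes_cons big_cons EFinD; apply: le_trans (measureU2 _ _ _) _.
  - exact: measurable_box.
  - exact: measurable_boxes.
  by apply: leeD => //; have <- := measure_box false t0; exact: lexx.
rewrite -lee_fin -(measure_box true)//; apply: le_trans.
apply: le_measure; rewrite ?inE; [exact: measurable_box|exact: measurable_boxes|].
exact: rT.
Qed.

(** Finite additivity, for half-open boxes so that packed boxes may share sides. *)
Lemma area_pack r (n : nat) (Q : nat -> rect R) :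
  (forall i, (i < n)%N -> rect_okb (Q i)) -> rect_okb r ->
  (forall i z, (i < n)%N -> mem_box true (Q i) z -> mem_box false r z) ->
  (forall i j z, (i < n)%N -> (j < n)%N ->
     mem_box true (Q i) z -> mem_box true (Q j) z -> i = j) ->
  \sum_(i < n) area (Q i) <= area r.
Proof.
move=> Q0 r0 Qr Qd; rewrite -lee_fin -(measure_box false)//.
have defU k : [set z | has (mem_box true ^~ z) (mkseq Q k.+1)] =
    [set z | has (mem_box true ^~ z) (mkseq Q k)] `|` [set` mem_box true (Q k)].
  rewrite /mkseq -addn1 iotaD map_cat; apply/seteqP; split=> z /=.
    by rewrite has_cat /= orbF => /orP.
  by move=> H; rewrite has_cat /= orbF; apply/orP.
have {}defU k : (k <= n)%N -> (mu [set z | has (mem_box true ^~ z) (mkseq Q k)]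
       = (\sum_(i < k) area (Q i))%:E)%E.
  elim: k => [|k IH] kn.
    rewrite big_ord0 (_ : [set _ | _] = set0); first by rewrite measure0.
    by apply/seteqP; split.
  rewrite defU big_ord_recr /= measureU.
  - by rewrite EFinD -(IH (ltnW kn)) -(measure_box true (Q0 k kn)).
  - exact: measurable_boxes.
  - exact: measurable_box.
  apply/seteqP; split=> z //=; rewrite has_map => -[/hasP[i]].
  rewrite mem_iota /= add0n => ik Qi Qk.
  have := Qd i k z (ltn_trans ik kn) kn Qi Qk.
  by move=> eik; rewrite eik ltnn in ik.
rewrite -defU//; apply: le_measure; rewrite ?inE.
- exact: measurable_boxes.
- exact: measurable_box.
move=> z /=; rewrite has_map => /hasP[i]; rewrite mem_iota /= add0n.
exact: Qr.
Qed.

End PlaneArea.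

(** * Tiles, their arms and the charging rectangles *)

Section Tiles.
Context {R : realType}.
Implicit Types (n i : nat) (f g A : nat -> R).

(* The points [(f i, g i)], [i < n], are listed in processing order, and [A i] is
   the area of the greedy rectangle at the [i]-th one.  In [ga_max] the rectangle
   avoids the whole quadrants above the previous points, hence also the greedy
   rectangles anchored there. *)
Record greedy_areas n f g A : Prop := {
  ga_unit : forall i, (i < n)%N -> [/\ 0 <= f i, f i <= 1, 0 <= g i & g i <= 1];
  ga_sum : forall i j, (i <= j)%N -> (j < n)%N -> f j + g j <= f i + g i;
  ga_inj : forall i j, (i < j)%N -> (j < n)%N -> f i = f j -> g i = g j -> False;
  ga_ge0 : forall i, (i < n)%N -> 0 <= A i;
  ga_max : forall i w h, (i < n)%N -> 0 <= w -> 0 <= h ->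
    f i + w <= 1 -> g i + h <= 1 ->
    (forall j, (j < i)%N -> f j < f i + w -> g j < g i + h -> False) ->
    w * h <= A i }.

Lemma greedy_areas_swap n f g A : greedy_areas n f g A -> greedy_areas n g f A.
Proof.
case=> u s d p m; split=> //.
- by move=> i /u[].
- by move=> i j ij jn; rewrite addrC [leRHS]addrC; exact: s.
- by move=> i j ij jn e1 e2; exact: d e2 e1.
- move=> i w h ni w0 h0 fw gh H; rewrite mulrC; apply: m => // j ji a b.
  exact: H b a.
Qed.

Definition in_tile f g i (x y : R) : Prop :=
  [/\ f i <= x < 1, g i <= y < 1 &
      forall j, (j < i)%N -> f j <= x -> g j <= y -> False].

(** Selects the earlier points that bound a tile: the leftmost one not above [p_i], which fixes the
    width [a], and the lowest one with abscissa up to [f i + 2/3 * a], which fixes [eta]. *)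
Lemma min_below (P : pred nat) (v : nat -> R) i :
  (forall j, (j < i)%N -> ~~ P j) \/
  exists j, [/\ (j < i)%N, P j & forall k, (k < i)%N -> P k -> v j <= v k].
Proof.
elim: i => [|i [IH|[j [ji Pj Hj]]]]; first by left.
- have [Pi|nPi] := boolP (P i); last first.
    by left=> j; rewrite ltnS leq_eqVlt => /orP[/eqP->|/IH].
  right; exists i; split=> // k; rewrite ltnS leq_eqVlt => /orP[/eqP->//|/IH].
  by move/negP.
- have [/andP[Pi vi]|] := boolP (P i && (v i <= v j)).
    right; exists i; split=> // k; rewrite ltnS leq_eqVlt => /orP[/eqP->//|ki Pk].
    exact: le_trans vi (Hj _ ki Pk).
  rewrite negb_and -ltNge => Hi; right; exists j; split=> //; first exact: ltnW.
  move=> k; rewrite ltnS leq_eqVlt => /orP[/eqP->Pi|]; last exact: Hj.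
  by rewrite Pi /= in Hi; exact: ltW.
Qed.

(* Data of the right arm of tile [i]: [a] is the width of the tile, and the
   tile has constant height [eta] from abscissa [f i + w] on; unless [w = 0],
   the drop to height [eta] is caused by an earlier point at [f i + w]. *)
Record right_arm f g A i (a eta w : R) : Prop := {
  arm_gt0 : 0 < a;
  arm_eta : 0 < eta;
  arm_ge0 : 0 <= w;
  arm_le : w + w / 2 <= a;
  arm_unit : f i + a <= 1;
  arm_width : forall j, (j < i)%N -> g j <= g i -> f i + a <= f j;
  arm_right : forall x y, in_tile f g i x y -> x < f i + a;
  arm_height : forall x y, in_tile f g i x y -> f i + w <= x -> y < g i + eta;
  arm_area : a * eta <= 3 / 2 * A i;
  arm_corner : w = 0 \/ exists2 r, (r < i)%N &
    [/\ f r = f i + w, g i <= g r &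
        forall q, (q < i)%N -> f q <= f r -> g r <= g q] }.

(** The rectangle of width [2/3 * a] and height [eta] at [p_i] avoids all earlier quadrants, so its
    area is at most [A i]; this is [arm_area]. *)
Lemma right_armP n f g A i : greedy_areas n f g A -> (i < n)%N ->
  f i < 1 -> g i < 1 -> exists a eta w, right_arm f g A i a eta w.
Proof.
move=> G ni fi gi.
have [a [a0 a1 aw ar]] : exists a : R, [/\ 0 < a, f i + a <= 1,
    forall j, (j < i)%N -> g j <= g i -> f i + a <= f j &
    forall x y, in_tile f g i x y -> x < f i + a].
  have [H|[j [ji gj Hj]]] := min_below (fun j => g j <= g i) f i.
    exists (1 - f i); split=> [||j /H/negP//|x y [x1 _ _]]; lra.
  have jn := ltn_trans ji ni.
  exists (f j - f i); split=> [||k ki gk|].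
  - have := ga_sum G (ltnW ji) ni; have := ga_inj G ji ni.
    (* An earlier point straight below [p_i] would have a smaller coordinate sum. *)
    have [->|] := eqVneq (f j) (f i); last by move=> /eqP; lra.
    by move=> /(_ erefl) H s; exfalso; apply: H; lra.
  - by have [] := ga_unit G jn; lra.
  - by have := Hj _ ki gk; lra.
  - by move=> x y [_ y1 /(_ j ji)]; rewrite ltNge => H; apply/negP => xj; apply: H; lra.
have low j : (j < i)%N -> f j <= f i + 2 / 3 * a -> g i < g j.
  by move=> ji fj; rewrite ltNge; apply/negP => /(aw _ ji); lra.
have area_le (eta : R) : 0 < eta -> g i + eta <= 1 ->
    (forall q, (q < i)%N -> f q <= f i + 2 / 3 * a -> g i + eta <= g q) ->
    a * eta <= 3 / 2 * A i.
  move=> e0 e1 H; suff: 2 / 3 * a * eta <= A i by lra.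
  apply: (ga_max G) => //; try lra.
  by move=> j ji fj gj; have := H j ji (ltW fj); lra.
(* Without such a point, [eta] reaches the top of the square and [w = 0]. Otherwise [r] fixes [eta],
   and [w = 0] if [r] is not to the right of [p_i]. *)
have [H|[r [ri fr Hr]]] := min_below (fun j => f j <= f i + 2 / 3 * a) g i.
  exists a, (1 - g i), 0; split=> //; try lra.
  - by move=> x y [_ y1 _] _; lra.
  - by apply: area_le => [||j /H/negP//]; lra.
have rn := ltn_trans ri ni.
exists a, (g r - g i), (Num.max 0 (f r - f i)).
have e0 := low r ri fr.
split=> //; try lra.
- by rewrite le_max lexx.
- by case: (lerP 0 (f r - f i)) => ?; lra.
- move=> x y [_ _ H]; have := H _ ri; case: (lerP 0 (f r - f i)) => ? {}H ?;
  by rewrite ltNge; apply/negP => ?; apply: H; lra.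
- apply: area_le; [lra| |move=> q qi fq; have := Hr q qi fq; lra].
  by have [] := ga_unit G rn; lra.
- case: (lerP 0 (f r - f i)) => rpos; last by left.
  right; exists r => //; split; [lra|lra|move=> q qi fq].
  by apply: Hr => //; lra.
Qed.

(** The boxes [Q i] are packed into [[0, 1] x [0, 2]]: the top of [Q i] is at most the coordinate
    sum of the point [r] at its corner. The case [w i = 0 /\ a i = 0] serves points without an
    arm. *)
Lemma right_charge n f g A (a eta w : nat -> R) : greedy_areas n f g A ->
  (forall i, (i < n)%N -> right_arm f g A i (a i) (eta i) (w i) \/ w i = 0 /\ a i = 0) ->
  \sum_(i < n) (a i - w i) * w i <= 2.
Proof.
move=> G ra.
pose Q i := Rect (f i + w i, f i + g i) (a i - w i) (w i).
have wa i : (i < n)%N -> 0 <= w i <= a i.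
  by move=> /ra[[]|[-> ->]]; [lra|rewrite lexx].
have cornerP i : (i < n)%N -> 0 < w i -> right_arm f g A i (a i) (eta i) (w i) /\
    exists2 r, (r < i)%N &
    [/\ f r = f i + w i, g i <= g r &
        forall q, (q < i)%N -> f q <= f r -> g r <= g q].
  move=> ni w0; case: (ra i ni) => [rai|[e _]]; last by rewrite e ltxx in w0.
  by split=> //; case: (arm_corner rai) => [e|//]; rewrite e ltxx in w0.
have -> : 2 = area (Rect ((0, 0) : pt R) 1 2) by rewrite /area /= mul1r.
have -> : \sum_(i < n) (a i - w i) * w i = \sum_(i < n) area (Q i) by [].
apply: area_pack.
- by move=> i ni; have := wa i ni; rewrite /rect_okb /=; lra.
- by rewrite /rect_okb /=; lra.
- move=> i [x s] ni; rewrite /mem_box /= !in_itv /= => /andP[xi si].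
  have [rai [r ri [fr gr _]]] : _ := cornerP i ni ltac:(lra).
  have [] := ga_unit G ni; have [] := ga_unit G (ltn_trans ri ni).
  by have := arm_unit rai; move=> *; apply/andP; split; lra.
suff H i j x s : (i < n)%N -> (j < n)%N -> g i <= g j ->
    mem_box true (Q i) (x, s) -> mem_box true (Q j) (x, s) -> i = j.
  move=> i j [x s] ni nj; have [gij|/ltW gij] := leP (g i) (g j); first exact: H.
  by move=> mi mj; apply/esym; exact: (H j i x s).
rewrite /mem_box /= !in_itv /= => ni nj gij /andP[xi si] /andP[xj sj].
have [rai [r ri [fr gr minr]]] := cornerP i ni ltac:(lra).
have [raj _] := cornerP j nj ltac:(lra).
have [ij|ji|//] := ltngtP i j; exfalso.
  (* Tile [j] ends at or before [f i], so [Q j] lies to the left of [Q i]. *)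
  by have := arm_width raj ij gij; lra.
(* [p_r] precedes [p_j]: its coordinate sum exceeds [f i + g i + w i > s].  It is
   neither below [p_j], by the width of tile [j], nor above it, since [p_j]
   would lower tile [i] before the abscissa [f r]. *)
have rj : (r < j)%N.
  rewrite ltnNge; apply/negP => jr.
  by have := ga_sum G jr (ltn_trans ri ni); lra.
have [gr'|gr'] := leP (g r) (g j); first by have := arm_width raj rj gr'; lra.
have [fj|fj] := leP (f j) (f r); last lra.
by have := minr j ji fj; lra.
Qed.

(** * Geometric covers of the arms *)

Lemma geo_index (s q u : R) N : s <= u -> u < s * q ^+ N ->
  exists k, [/\ (k < N)%N, s * q ^+ k <= u & u < s * q ^+ k.+1].
Proof.
move=> su; elim: N => [|N IH] uN; first by rewrite expr0 mulr1 ltNge su in uN.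
have [Nu|/IH[k [kN ku uk]]] := leP (s * q ^+ N) u; first by exists N.
by exists k; split=> //; exact: ltnW.
Qed.

(* [m.+1] boxes of ratio 3/2 and area [A / 2] reach the abscissa [w], where
   [w > sqrt A * (3/2)^m].  The constants are a nearly optimal linear bound that
   yields 0.85 / 8.1 > 0.1039 in the end. *)
Lemma geo_bound m :
  m.+1%:R / 2 <= 41 / 20 + 3 / 160 * ((3 / 2) ^+ m) ^+ 2 :> R.
Proof.
pose c : R := 9 / 4.
have -> : ((3 / 2) ^+ m) ^+ 2 = c ^+ m :> R.
  by rewrite -exprM mulnC exprM; congr (_ ^+ _); rewrite /c; field.
have [m5|m5] := leqP 5 m; last first.
  by move: m m5; do 5?[case=> [_|]]; rewrite // ?exprS ?expr0 /c; lra.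
rewrite -(subnK m5); elim: (m - 5)%N => [|k IH].
  by rewrite add0n !exprS expr0 /c; lra.
(* This makes the right side grow by at least [3/160 * 5/4 * 22 > 1/2] per step. *)
have c5 : 22 <= c ^+ (k + 5).
  rewrite exprD -[leLHS]mul1r; apply: ler_pM => //.
    by rewrite exprn_ege1// /c; lra.
  by rewrite !exprS expr0 /c; lra.
rewrite addSn exprS -[_.+2%:R]natr1 /c -/c; move: IH c5.
by move: (c ^+ _) ((k + 5).+1%:R) => C M; rewrite /c; lra.
Qed.

Lemma geo_unbounded (s u : R) : 0 < s -> exists N, u <= s * (3 / 2) ^+ N.
Proof.
move=> s0; have H N : N%:R / 2 <= (3 / 2) ^+ N :> R.
  elim: N => [|N IH]; first by rewrite expr0; lra.
  rewrite exprS -natr1.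
  have : 1 <= (3 / 2 : R) ^+ N by apply: exprn_ege1; lra.
  by lra.
exists (Num.bound (2 * (`|u| / s))).
rewrite mulrC -ler_pdivrMr//; apply: le_trans (H _).
have : 2 * (`|u| / s) < (Num.bound (2 * (`|u| / s)))%:R.
  by apply: archi_boundP; rewrite mulr_ge0// divr_ge0// ltW.
have : u / s <= `|u| / s by rewrite ler_pM2r ?invr_gt0// ler_norm.
by lra.
Qed.

Lemma tile_hyperbola n f g A i x y : greedy_areas n f g A -> (i < n)%N ->
  in_tile f g i x y -> (x - f i) * (y - g i) <= A i.
Proof.
move=> G ni [xi yi H]; apply: (ga_max G) => //; try lra.
by move=> j ji fj gj; apply: (H j ji); lra.
Qed.

(** One box covers the arm beyond [w]. Before it, the box from [s * q ^+ k] to [s * q ^+ k.+1] has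
    the height [s / q ^+ k] of the hyperbola at its left side, hence area [A i / 2]. *)
Lemma right_cover n f g A i s a eta w : greedy_areas n f g A -> (i < n)%N ->
  right_arm f g A i a eta w -> 0 < s -> s ^+ 2 = A i ->
  exists T, [/\ all rect_okb T,
    forall x y, in_tile f g i x y -> f i + s <= x -> has (mem_box false ^~ (x, y)) T &
    \sum_(t <- T) area t <= (3 / 2 + 41 / 20) * A i + 3 / 80 * ((a - w) * w)].
Proof.
move=> G ni ra s0 sA; pose q : R := 3 / 2.
have q0 N : 0 < q ^+ N by rewrite exprn_gt0// /q; lra.
have [[[a0 e0] w0] wa] := (arm_gt0 ra, arm_eta ra, arm_ge0 ra, arm_le ra).
(* For positive [N], minimality gives [s * q ^+ N.-1 < w], which turns the number of boxes into a
   term in [w * w]. *)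
have [N wN minN] : exists2 N, w <= s * q ^+ N &
    forall m, w <= s * q ^+ m -> (N <= m)%N.
  have exN := geo_unbounded w s0.
  by exists (ex_minn exN); case: ex_minnP.
exists (Rect (f i + w, g i) (a - w) eta ::
  [seq Rect (f i + s * q ^+ k, g i) (s * q ^+ k / 2) (s / q ^+ k) | k <- iota 0 N]).
split.
- rewrite /= all_map; apply/andP; split; first by rewrite /rect_okb /=; lra.
  apply/allP => k _; rewrite /= /rect_okb /=.
  have := mulr_gt0 s0 (q0 k); have : 0 < s / q ^+ k by rewrite divr_gt0.
  lra.
- move=> x y xy sx /=; apply/orP.
  have [[x1 y1 _] xa] := (xy, arm_right ra xy).
  have [wx|xw] := leP (f i + w) x.
    left; have := arm_height ra xy wx.
    by rewrite /mem_box /= !in_itv /=; lra.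
  right; rewrite has_map; apply/hasP.
  have [||k [kN ku uk]] := @geo_index s q (x - f i) N; try lra.
  exists k; first by rewrite mem_iota.
  rewrite /= /mem_box /= !in_itv /=.
  have qE : s * q ^+ k.+1 = s * q ^+ k + s * q ^+ k / 2 by rewrite exprS /q; lra.
  suff: y - g i <= s / q ^+ k by lra.
  rewrite ler_pdivlMr// -(ler_pM2l s0) -expr2 sA.
  apply: le_trans (tile_hyperbola G ni xy); nra.
- rewrite big_cons big_map {1}/area /= (eq_bigr (fun=> A i / 2)); last first.
    move=> k _; rewrite /area /= -sA; field.
    by rewrite gt_eqF.
  have -> : \sum_(k <- iota 0 N) A i / 2 = N%:R / 2 * A i.
    by rewrite big_const_seq count_predT size_iota iter_addr_0 -mulr_natr; lra.
  have A0 := ga_ge0 G ni.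
  have w2 : w * w <= 2 * ((a - w) * w) by nra.
  have area1 : (a - w) * eta <= 3 / 2 * A i by have := arm_area ra; nra.
  suff: N%:R / 2 * A i <= 41 / 20 * A i + 3 / 160 * (w * w) by lra.
  case: N wN minN => [|m] _ minN; first by nra.
  have wm : s * q ^+ m < w.
    by rewrite ltNge; apply/negP => /minN; rewrite ltnn.
  have := geo_bound m; rewrite -/q => gb.
  have sq : A i * (q ^+ m) ^+ 2 <= w * w.
    by rewrite -sA -exprMn -expr2 ler_sqr ?nnegrE// ltW// mulr_gt0.
  have := ler_wpM2r A0 gb; lra.
Qed.

End Tiles.

Lemma has_flatten (T : Type) (p : pred T) (ss : seq (seq T)) :
  has p (flatten ss) = has (has p) ss.
Proof. by elim: ss => //= s ss IH; rewrite has_cat IH. Qed.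

Lemma all_flatten (T : Type) (p : pred T) (ss : seq (seq T)) :
  all p (flatten ss) = all (all p) ss.
Proof. by elim: ss => //= s ss IH; rewrite all_cat IH. Qed.

(** * Summing the covers over all tiles *)

Section Bound.
Context {R : realType}.
Implicit Types (n i : nat) (f g A : nat -> R).

(** A point on the right or top side of the square has an empty tile; its data default to zero, so
    that the sum runs over all indices. *)
Lemma right_arms n f g A : greedy_areas n f g A ->
  exists a eta w : nat -> R, [/\
    forall i, (i < n)%N -> f i < 1 -> g i < 1 ->
      right_arm f g A i (a i) (eta i) (w i),
    forall i, (i < n)%N -> 0 <= (a i - w i) * w i &
    \sum_(i < n) (a i - w i) * w i <= 2].
Proof.
move=> G.
have [d Hd] : {d : nat -> R * R * R & forall i, (i < n)%N ->
    if (f i < 1) && (g i < 1) then right_arm f g A i (d i).1.1 (d i).1.2 (d i).2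
    else d i = (0, 0, 0)}.
  apply: (@boolp.choice _ _ (fun i (e : R * R * R) => (i < n)%N ->
    if (f i < 1) && (g i < 1) then right_arm f g A i e.1.1 e.1.2 e.2
    else e = (0, 0, 0))) => i.
  have [ni|] := boolP (i < n)%N; last by exists (0, 0, 0).
  have [/andP[fi gi]|_] := boolP (_ && _); last by exists (0, 0, 0).
  by have [a [eta [w H]]] := right_armP G ni fi gi; exists (a, eta, w).
exists (fun i => (d i).1.1), (fun i => (d i).1.2), (fun i => (d i).2); split.
- by move=> i /Hd + fi gi; rewrite fi gi.
- move=> i /Hd; case: ifP => [_ ra|_ -> /=]; last by rewrite mulr0.
  by have := arm_le ra; have := arm_ge0 ra => w0 wa; rewrite mulr_ge0//; lra.
apply: (@right_charge _ n f g A (fun i => (d i).1.1) (fun i => (d i).1.2)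
  (fun i => (d i).2) G) => i /Hd.
by case: ifP => _ H; [left | right; rewrite H].
Qed.

Definition swap_rect (r : rect R) : rect R :=
  Rect (yc (corner r), xc (corner r)) (height r) (width r).

Lemma has_swap b T x y :
  has (mem_box b ^~ (x, y)) (map swap_rect T) = has (mem_box b ^~ (y, x)) T.
Proof. by rewrite has_map; apply: eq_has => t; rewrite /= /mem_box andbC. Qed.

Lemma in_tile_swap f g i x y : in_tile f g i x y -> in_tile g f i y x.
Proof. by case=> xi yi H; split=> // j ji gj fj; exact: H fj gj. Qed.

(** A square of side [sqrt (A i)] covers the corner, and each arm is covered beyond it, the upper
    one after exchanging coordinates. Here [81/10 = 1 + 2 * (3/2 + 41/20)]. *)
Lemma tile_cover n f g A i a eta w a' eta' w' :
  greedy_areas n f g A -> (i < n)%N ->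
  right_arm f g A i a eta w -> right_arm g f A i a' eta' w' ->
  exists T, [/\ all rect_okb T,
    forall x y, in_tile f g i x y -> has (mem_box false ^~ (x, y)) T &
    \sum_(t <- T) area t <=
      81 / 10 * A i + 3 / 80 * ((a - w) * w) + 3 / 80 * ((a' - w') * w')].
Proof.
move=> G ni ra ra'; have G' := greedy_areas_swap G.
have A0 : 0 < A i.
  by have := arm_area ra; have := mulr_gt0 (arm_gt0 ra) (arm_eta ra); lra.
pose s := Num.sqrt (A i).
have s0 : 0 < s by rewrite sqrtr_gt0.
have sA : s ^+ 2 = A i by rewrite sqr_sqrtr// ltW.
have [T [T0 Tcov Tarea]] := right_cover G ni ra s0 sA.
have [T' [T'0 T'cov T'area]] := right_cover G' ni ra' s0 sA.
exists (Rect (f i, g i) s s :: T ++ map swap_rect T'); split.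
- rewrite /= all_cat T0 /rect_okb /= ltW//= all_map.
  by apply: sub_all T'0 => t /=; rewrite /rect_okb andbC.
- move=> x y xy; rewrite /= has_cat has_swap.
  have [sx|xs] := leP (f i + s) x; first by rewrite Tcov// orbT.
  have [sy|ys] := leP (g i + s) y.
    by rewrite (T'cov _ _ (in_tile_swap xy) sy) !orbT.
  have [xi yi _] := xy; rewrite /mem_box /= !in_itv /=.
  by apply/orP; left; lra.
- rewrite big_cons big_cat big_map {1}/area /= -expr2 sA.
  have -> : \sum_(t <- T') area (swap_rect t) = \sum_(t <- T') area t.
    by apply: eq_bigr => t _; rewrite /area /= mulrC.
  lra.
Qed.

Theorem greedy_areas_bound n f g A : greedy_areas n f g A ->
  (exists i, [/\ (i < n)%N, f i = 0 & g i = 0]) ->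
  10390%:R / 100000%:R <= \sum_(i < n) A i.
Proof.
move=> G [i0 [ni0 fi0 gi0]]; suff: 1039 / 10000 <= \sum_(i < n) A i by lra.
have [a [eta [w [ra q0 aw]]]] := right_arms G.
have [a' [eta' [w' [ra' q0' aw']]]] := right_arms (greedy_areas_swap G).
have [T HT] : {T : nat -> seq (rect R) & forall i, (i < n)%N -> [/\ all rect_okb (T i),
    forall x y, in_tile f g i x y -> has (mem_box false ^~ (x, y)) (T i) &
    \sum_(t <- T i) area t <=
      81 / 10 * A i + 3 / 80 * ((a i - w i) * w i) + 3 / 80 * ((a' i - w' i) * w' i)]}.
  apply: (@boolp.choice _ _ (fun i T => (i < n)%N -> [/\ all rect_okb T,
    forall x y, in_tile f g i x y -> has (mem_box false ^~ (x, y)) T &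
    \sum_(t <- T) area t <=
      81 / 10 * A i + 3 / 80 * ((a i - w i) * w i) + 3 / 80 * ((a' i - w' i) * w' i)])) => i.
  have [ni|] := boolP (i < n)%N; last by exists [::].
  have [/andP[fi gi]|nU] := boolP ((f i < 1) && (g i < 1)).
    by have [T HT] := tile_cover G ni (ra i ni fi gi) (ra' i ni gi fi); exists T.
  exists [::] => _; split=> // [x y [xi yi _]|].
    by move: nU; rewrite negb_and -!leNgt => /orP[]; lra.
  rewrite big_nil; have := ga_ge0 G ni; have := q0 i ni; have := q0' i ni; lra.
have cov : area (Rect ((0, 0) : pt R) 1 1) <=
    \sum_(t <- flatten [seq T i | i <- iota 0 n]) area t.
  apply: area_cover.
  - by rewrite /rect_okb /= ler01.
  - rewrite all_flatten all_map; apply/allP => i.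
    by rewrite mem_iota /= => /HT[].
  - move=> [x y]; rewrite /mem_box /= !in_itv /= => xy.
    rewrite has_flatten has_map; apply/hasP.
    (* The first point in processing order dominated by [(x, y)] owns the tile containing it; the
       origin ensures that there is one. *)
    pose P i := [&& (i < n)%N, f i <= x & g i <= y].
    have exP : exists i, P i by exists i0; rewrite /P ni0 fi0 gi0; lra.
    case: (ex_minnP exP) => i /and3P[ni fi gi] mini.
    exists i; first by rewrite mem_iota.
    have [_ /(_ x y) + _] := HT i ni; apply; split; [lra|lra|move=> j ji fj gj].
    have := mini j; rewrite /P fj gj (ltn_trans ji ni) => /(_ isT).
    by rewrite leqNgt ji.
move: cov; rewrite big_flatten big_map /area /= mul1r => cov.
have : 1 <= \sum_(i < n) (81 / 10 * A i + 3 / 80 * ((a i - w i) * w i)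
                           + 3 / 80 * ((a' i - w' i) * w' i)).
  apply: le_trans cov _; rewrite -(subn0 n) -/(index_iota 0 n) big_mkord subn0.
  by apply: ler_sum => i _; have [_ _] := HT i (ltn_ord i).
(* Both charge sums are at most 2, so [1 <= 81/10 * sum A + 4 * 3/80]. *)
rewrite !big_split /= -!mulr_sumr => H.
lra.
Qed.

End Bound.

(** * Existence of greedy runs and their reduction to [greedy_areas] *)

Section Greedy.
Context {R : realType}.
Implicit Types (S ord : seq (pt R)) (p q z : pt R) (Rs prev : seq (rect R)).
Local Notation r0 := (Rect ((0, 0) : pt R) 0 0).

Lemma closed_avoid p z :
  closed [set wh : R * R | ~ in_interior (Rect p wh.1 wh.2) z]%classic.
Proof.
have [[pz1 pz2]|npz] := pselect (xc p < xc z /\ yc p < yc z); last first.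
  rewrite (_ : [set _ | _] = setT)%classic; first exact: closedT.
  by apply/seteqP; split=> // wh _ [/= /andP[? _] /andP[? _]]; apply: npz.
rewrite (_ : [set _ | _] = (fst @^-1` [set w | w <= xc z - xc p]%R) `|`
                           (snd @^-1` [set h | h <= yc z - yc p]%R))%classic.
  apply: closedU; (apply: preimage_closed; last exact: closed_le) => x _.
    exact: cvg_fst.
  exact: cvg_snd.
apply/seteqP; split=> [[w h] /= H|[w h] /= H [/= /andP[_ ?] /andP[_ ?]]]; last first.
  by case: H; lra.
have [?|wz] := leP w (xc z - xc p); [by left|right].
by rewrite leNgt; apply/negP => hz; apply: H; split=> /=; apply/andP; split=> //; lra.
Qed.

(** The admissible pairs of width and height form a compact set containing [(0, 0)], on which the
    product is continuous. *)
Lemma exists_max_candidate S prev p : inU p ->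
  exists r, candidate S prev p r /\
    forall r', candidate S prev p r' -> area r' <= area r.
Proof.
move=> [/andP[px0 px1] /andP[py0 py1]].
(* Emptiness and disjointness both mean keeping these points out of the interior, a closed condition
   for each point. *)
pose bad : set (pt R) := [set z | z \in S \/
  exists2 k, (k < size prev)%N & in_interior (nth r0 prev k) z]%classic.
pose K : set (R * R) := ((`[0, 1 - xc p] `*` `[0, 1 - yc p]) `&`
  \bigcap_(z in bad) [set wh : R * R | ~ in_interior (Rect p wh.1 wh.2) z])%classic.
have candK r : candidate S prev p r <-> corner r = p /\ K (width r, height r).
  case: r => c w h; rewrite /candidate /anchored_at /rect_ok /rect_in_U /=.
  split=> [[[[w0 h0] ->] [[_ [w1 [_ h1]]] [dis emp]]]|[-> [[/= w1 h1] av]]].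
    split=> //; split=> [|z [zS|[k kn kz]] /= zi] /=.
    - by rewrite !in_itv /=; lra.
    - exact: (emp z).
    - exact: (dis k kn z).
  move: w1 h1; rewrite !in_itv /= => /andP[w0 w1] /andP[h0 h1].
  do ![split=> //]; try lra.
  - by move=> k kn z [zi zk]; apply: (av z) => //; right; exists k.
  - by move=> q qS qi; apply: (av q) => //; left.
have K0 : (K !=set0)%classic.
  exists (0, 0); split=> [|z _ [/= /andP[]]]; first by split; rewrite /= in_itv /=; lra.
  by rewrite addr0 => a b; lra.
have cK : compact K.
  apply: compact_closedI; first by apply: compact_setX; exact: segment_compact.
  by apply: closed_bigI => z _; exact: closed_avoid.
have cf : {within K, continuous (fun wh : R * R => wh.1 * wh.2)}%classic.
  by apply: continuous_subspaceT => x; apply: cvgM; [exact: cvg_fst|exact: cvg_snd].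
have [[w h] Kwh maxwh] := compact_EVT_max K0 cK cf.
exists (Rect p w h); split; first by apply/candK; split=> //; exact/set_mem.
by move=> r /candK[_ Kr]; apply: (maxwh (width r, height r)); exact/mem_set.
Qed.

Lemma exists_greedy_run S ord : (forall p, p \in ord -> inU p) ->
  exists Rs, greedy_run S ord Rs.
Proof.
move=> ordU; suff [Rs [sz H]] : exists Rs, size Rs = size ord /\
    forall i, (i < size ord)%N ->
    candidate S (take i Rs) (nth (0,0) ord i) (nth r0 Rs i) /\
    (forall r, candidate S (take i Rs) (nth (0,0) ord i) r ->
       area r <= area (nth r0 Rs i)) by exists Rs.
elim/last_ind: ord ordU => [|ord p IH] ordU; first by exists [::].
have [|Rs [sz H]] := IH.
  by move=> q qo; apply: ordU; rewrite mem_rcons inE qo orbT.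
have [|r [rc rmax]] := @exists_max_candidate S Rs p.
  by apply: ordU; rewrite mem_rcons mem_head.
exists (rcons Rs r); split; first by rewrite !size_rcons sz.
move=> i; rewrite size_rcons ltnS => il.
rewrite -cats1 takel_cat ?sz// cats1 !nth_rcons sz.
move: il; rewrite leq_eqVlt => /orP[/eqP->|il]; last by rewrite il; exact: H.
by rewrite ltnn eqxx -sz take_size.
Qed.

Lemma greedy_run_LLARP S ord Rs :
  perm_eq ord S -> greedy_run S ord Rs -> is_LLARP S Rs.
Proof.
move=> po [sz H]; have mapc : map (@corner R) Rs = ord.
  apply: (@eq_from_nth _ (0, 0)); rewrite size_map// sz => i il.
  by rewrite (nth_map r0) ?sz//; have [[[_ ->]]] := H i il.
have dis i j : (i < size Rs)%N -> (j < i)%N ->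
    interior_disjoint (nth r0 Rs i) (nth r0 Rs j).
  move=> il ji; rewrite sz in il; have [[_ [_ [dis _]]] _] := H i il.
  by have := dis j; rewrite size_take sz il nth_take//; exact.
split; first by rewrite mapc.
split=> [i|]; first by rewrite sz => /H[[[]]].
split=> [i|]; first by rewrite sz => /H[[_ []]].
split=> [i j il jl /eqP|i]; last by rewrite sz => /H[[_ [_ []]]].
rewrite neq_ltn => /orP[ij z [zi zj]|]; last exact: dis.
exact: (dis j i jl ij z).
Qed.

Lemma greedy_run_areas S ord Rs : uniq S -> (forall p, p \in S -> inU p) ->
  greedy_order S ord -> greedy_run S ord Rs ->
  greedy_areas (size ord) (fun i => xc (nth (0, 0) ord i))
    (fun i => yc (nth (0, 0) ord i)) (fun i => area (nth r0 Rs i)).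
Proof.
move=> uS SU [po so] [sz H].
have sum i j : (i <= j)%N -> (j < size ord)%N ->
    xc (nth (0, 0) ord j) + yc (nth (0, 0) ord j) <=
    xc (nth (0, 0) ord i) + yc (nth (0, 0) ord i).
  move=> ij jn; have tr : transitive (fun p q => xc q + yc q <= xc p + yc p).
    by move=> q p z pq zq; exact: le_trans zq pq.
  apply: (sorted_leq_nth tr _ _ so) => //; rewrite ?inE//.
  exact: leq_ltn_trans ij jn.
split=> //.
- move=> i il; have /SU[] : nth (0, 0) ord i \in S.
    by rewrite -(perm_mem po) mem_nth.
  by move=> /andP[? ?] /andP[? ?].
- move=> i j ij jn e1 e2.
  have /eqP : nth (0, 0) ord i = nth (0, 0) ord j.
    rewrite [LHS]surjective_pairing [RHS]surjective_pairing.
    exact: f_equal2 e1 e2.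
  rewrite nth_uniq ?(ltn_trans ij jn)// ?(perm_uniq po)//.
  by rewrite ltn_eqF.
- by move=> i il; have [[[[w0 h0] _] _] _] := H i il; rewrite mulr_ge0.
- move=> i w h il w0 h0 w1 h1 av; have [_ Hmax] := H i il.
  apply: (Hmax (Rect (nth (0, 0) ord i) w h)).
  have iS : nth (0, 0) ord i \in S by rewrite -(perm_mem po) mem_nth.
  have [/andP[x0 _] /andP[y0 _]] := SU _ iS.
  do ![split=> //=].
  (* The interior of an earlier greedy rectangle lies in the quadrant above its corner, which [av]
     keeps out of reach. *)
  + move=> k; rewrite size_take sz il => ki z [[/= zx zy]].
    rewrite nth_take//; have [[[_ e] _] _] := H k (ltn_trans ki il).
    by rewrite /in_interior e => -[zx' zy']; apply: (av k ki); lra.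
  + move=> q; rewrite -(perm_mem po) => /(nthP (0, 0))[j jn <-] [/= qx qy].
    (* A point in the interior has a larger coordinate sum than the corner, hence comes earlier. *)
    have ji : (j < i)%N.
      by rewrite ltnNge; apply/negP => /sum /(_ jn); lra.
    by apply: (av j ji); lra.
Qed.

End Greedy.

Theorem theorem8 (R : realType) (S : seq (pt R)) :
  uniq S -> (forall p, p \in S -> inU p) -> ((0, 0) : pt R) \in S ->
  forall ord : seq (pt R), greedy_order S ord ->
    (exists Rs, greedy_run S ord Rs) /\
    (forall Rs, greedy_run S ord Rs ->
       is_LLARP S Rs /\ 10390%:R / 100000%:R <= total_area Rs).
Proof.
move=> uS SU S0 ord ordS; have [po _] := ordS; split.
  by apply: exists_greedy_run => p; rewrite (perm_mem po); exact: SU.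
move=> Rs run; split; first exact: greedy_run_LLARP po run.
have [sz _] := run.
rewrite /total_area (big_nth (Rect (0, 0) 0 0)) sz big_mkord.
apply: greedy_areas_bound (greedy_run_areas uS SU ordS run) _.
move: S0; rewrite -(perm_mem po) => /(nthP (0, 0))[i il i0].
by exists i; rewrite i0.
Qed.
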